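(* Let $\alpha$ be a (de)limiting functional on $\mathcal{L}$, and let the connection map $\mathcal{C}$ and the reflection map $\mathcal{R}$ both be $\alpha$-passive. Then for every time-limited excitation $e\in\mathcal{L}^{I}$ (i.e. $e$ supported on $[0,N\tau)\subset I$ for some integer $N\geqslant 1$), the DSC process $h$ excited with $e$ and generated by $\mathcal{C}$ and $\mathcal{R}$ is uniformly bounded, hence stable.
   Context: $(\mathcal{L},\|\cdot\|)$ is a real or complex normed linear space. A continuous non-negative functional $\alpha:\mathcal{L}\to\mathbb{R}$ is called (de)limiting iff there are non-negative real constants $a,b,c$ with $\|z\|\leqslant a+b(\alpha(z))^{c}$ for every $z\in\mathcal{L}$. Let $\tau>0$, $I=\{k\tau\mid k\in\mathbb{Z}\}$, $J=\{(2k+1)\tau/2\mid k\in\mathbb{Z}\}$, $H=I\cup J$. Each of $I$ and $J$ carries the measure $\mu$ giving weight $\tau$ to every point. For $s\in H$, $T_{s}$ denotes the shift operator $(T_{s}f)(t)=f(t+s)$; in particular $T_{-\tau/2}$ maps $\mathcal{L}^{I}$ to $\mathcal{L}^{J}$ and $\mathcal{L}^{J}$ to $\mathcal{L}^{I}$. Propagating fields: $\mathcal{P}=\mathcal{P}_{in}\times\mathcal{P}_{out}$ with $\mathcal{P}_{in}\cong\mathcal{P}_{out}\cong\mathcal{L}$ as normed spaces, so $\mathcal{P}\cong\mathcal{L}^{2}$ with norm $\|(a,b)\|^{\sim}=\sqrt{\|a\|^{2}+\|b\|^{2}}$ (or any equivalent norm). The node-boundary map is the involution $nb:\mathcal{P}\to\mathcal{P}$,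 $(z_{in},z_{out})\mapsto(z_{out},z_{in})$, which identifies $\mathcal{P}_{in}$ and $\mathcal{P}_{out}$ with each other. A connection map is a map $\mathcal{C}:I\times\mathcal{P}_{out}^{I}\to\mathcal{P}_{in}$ and a reflection map is a map $\mathcal{R}:J\times\mathcal{P}_{in}^{J}\to\mathcal{P}_{out}$, both operating on back-in-time running sequences of states, i.e. $\mathcal{C}(t,f)$ (resp. $\mathcal{R}(t,g)$) depends only on $t$ and the values $f(s)$ (resp. $g(s)$) with $s\leqslant t$. With $\mathcal{P}_{in}$ and $\mathcal{P}_{out}$ identified with each other via $nb$, and both identified with $\mathcal{L}$ via the isomorphisms of normed spaces $\mathcal{P}_{in}\cong\mathcal{P}_{out}\cong\mathcal{L}$, they define $F_{C}:\mathcal{L}^{I}\to\mathcal{L}^{I}$, $F_{C}f(t)=nb\circ\mathcal{C}(t,f)$, and $F_{R}:\mathcal{L}^{J}\to\mathcal{L}^{J}$, $F_{R}g(t)=nb\circ\mathcal{R}(t,g)$. For $K\in\{I,J\}$, a function $F:\mathcal{L}^{K}\to\mathcal{L}^{K}$ is causal iff $Ff(t)=F[\chi_{s\leqslant t}f(s)](t)$ for every $f\in\mathcal{L}^{K}$, $t\in K$ (where $\chi_{s\leqslant t}$ is $1$ if $s\leqslant t$ and $0$ otherwise). A causal $F$ is $\alpha$-passive iff $\int_{s<t}\alpha(Ff(s))\,d\mu(s)\leqslant\int_{s<t}\alpha(f(s))\,d\mu(s)$ for every $f\in\mathcal{L}^{K}$ and $t\in K$. The connection map $\mathcal{C}$ (resp.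 reflection map $\mathcal{R}$) is called $\alpha$-passive iff $F_{C}$ (resp. $F_{R}$) is $\alpha$-passive. The DSC process excited with $e\in\mathcal{L}^{I}$ (supported on a finite interval $[0,N\tau)\subset I$) and generated by $\mathcal{C}$ and $\mathcal{R}$ is the function $h=(h_{1},h_{2})\in(\mathcal{L}^{2})^{H}$ such that $h(t)=0$ for $t\leqslant 0$ and recursively, for $0\leqslant t\in H$, $$h\big(t+\tfrac{\tau}{2}\big)=\begin{cases}\big(h_{1}(t),\;T_{-\tau/2}F_{R}T_{-\tau/2}[e+h_{1}](t)\big)&\text{if }t\in I,\\ \big(T_{-\tau/2}F_{C}T_{-\tau/2}[h_{2}](t),\;h_{2}(t)\big)&\text{if }t\in J,\end{cases}$$ where inside the brackets $h_{1}$ is restricted to $I$ and $h_{2}$ is restricted to $J$. (By causality the right-hand sides only involve values of $h$ at times up to $t$.) A process is stable iff it is uniformly bounded in norm over its time domain.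
   Formalization: The formal theorem additionally assumes α(0)=0; without it the claim is false, since for α(0)>0 the passivity integrals over the infinite past are infinite (e.g. α(z)=1+|z|, F_C=2·id, F_R=id gives an unbounded process). *)

(* Defs.v *)
From HB Require Import structures.
From mathcomp Require Import all_boot all_order all_algebra.
From mathcomp Require Import all_classical all_reals all_analysis.
From mathcomp Require Import complex ring lra zify.
Set Implicit Arguments.
Unset Strict Implicit.
Unset Printing Implicit Defensive.
Import Order.TTheory GRing.Theory Num.Theory.
Import numFieldNormedType.Exports.
Local Open Scope classical_set_scope.
Local Open Scope ring_scope.

Variant scalars := RealScalars | ComplexScalars.

Definition scalar_field (R : realType) (k : scalars) : numFieldType :=
  match k with
  | RealScalars => R : numFieldType
  | ComplexScalars => R[i] : numFieldType
  end.

(* Norms of a complex [normedModType] take their values in [R[i]] (with zero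
   imaginary part); [rnorm] is the same norm with values in [R]. *)
Definition real_part (R : realType) (k : scalars) : scalar_field R k -> R :=
  match k return scalar_field R k -> R with
  | RealScalars => id
  | ComplexScalars => @complex.Re R
  end.

Definition rnorm (R : realType) (k : scalars)
  (L : normedModType (scalar_field R k)) (z : L) : R := real_part `|z|.

Definition delimiting (R : realType) (k : scalars)
    (L : normedModType (scalar_field R k)) (alpha : L -> R) : Prop :=
  [/\ continuous alpha,
      forall z, 0 <= alpha z
    & exists a b c : R, [/\ 0 <= a, 0 <= b, 0 <= c
        & forall z, rnorm z <= a + b * alpha z `^ c]].

Variant grid := GridI | GridJ | GridH.

Section Times.
Variables (R : realType) (tau : {posnum R}).

Definition timesI : set R := [set k%:~R * tau%:num | k in [set: int]].
Definition timesJ : set R :=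
  [set (2 * k + 1)%:~R * tau%:num / 2 | k in [set: int]].

Definition grid_set (K : grid) : set R :=
  match K with
  | GridI => timesI
  | GridJ => timesJ
  | GridH => timesI `|` timesJ
  end.

Definition times (K : grid) : Type := {x : R | x \in grid_set K}.

Lemma grid_set_nonempty (K : grid) : exists x, x \in grid_set K.
Proof.
case: K; [exists 0 | exists (tau%:num / 2) | exists 0]; apply: mem_set.
- by exists 0; rewrite ?mul0r.
- by exists 0; rewrite ?mul1r.
- by left; exists 0; rewrite ?mul0r.
Qed.

HB.instance Definition _ (K : grid) := Choice.on (times K).
HB.instance Definition _ (K : grid) :=
  isPointed.Build (times K)
    (exist _ (projT1 (cid (grid_set_nonempty K)))
             (projT2 (cid (grid_set_nonempty K)))).
HB.instance Definition _ (K : grid) :=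
  @isMeasurable.Build default_measure_display (times K)
    discrete_measurable discrete_measurable0
    discrete_measurableC discrete_measurableU.

Definition mu (K : grid) : {measure set (times K) -> \bar R} :=
  mscale (tau%:num)%:nng (@counting (times K) R).

Lemma timesJ_subr t : timesJ t -> timesI (t - tau%:num / 2).
Proof.
case=> k _ <-; exists k => //.
by rewrite rmorphD rmorphM /=; field.
Qed.

Lemma timesI_subr t : timesI t -> timesJ (t - tau%:num / 2).
Proof.
case=> k _ <-; exists (k - 1) => //.
have -> : 2 * (k - 1) + 1 = 2 * k - 1 :> int by ring.
by rewrite rmorphB rmorphM /=; field.
Qed.

Lemma timesJ_addr t : timesJ t -> timesI (t + tau%:num / 2).
Proof.
case=> k _ <-; exists (k + 1) => //.
by rewrite !rmorphD rmorphM /=; field.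
Qed.

Lemma timesI_addr t : timesI t -> timesJ (t + tau%:num / 2).
Proof.
case=> k _ <-; exists k => //.
by rewrite rmorphD rmorphM /=; field.
Qed.

Lemma timesIH t : timesI t -> grid_set GridH t. Proof. by left. Qed.
Lemma timesJH t : timesJ t -> grid_set GridH t. Proof. by right. Qed.

Lemma timesI_addrH t : timesI t -> grid_set GridH (t + tau%:num / 2).
Proof. by move/timesI_addr/timesJH. Qed.

Lemma timesJ_addrH t : timesJ t -> grid_set GridH (t + tau%:num / 2).
Proof. by move/timesJ_addr/timesIH. Qed.

Definition time_map (K K' : grid) (g : R -> R)
    (gKK' : forall t, grid_set K t -> grid_set K' (g t)) (t : times K) :
    times K' :=
  exist _ (g (val t)) (mem_set (gKK' (val t) (set_mem (valP t)))).

Definition inclI : times GridI -> times GridH :=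
  @time_map GridI GridH _ timesIH.
Definition inclJ : times GridJ -> times GridH :=
  @time_map GridJ GridH _ timesJH.
Definition nextI : times GridI -> times GridH :=
  @time_map GridI GridH _ timesI_addrH.
Definition nextJ : times GridJ -> times GridH :=
  @time_map GridJ GridH _ timesJ_addrH.

(* [shiftI] and [shiftJ] are T_{-tau/2} on sequences indexed by I and by J. *)
Definition shiftI (L : Type) (f : times GridI -> L) : times GridJ -> L :=
  f \o @time_map GridJ GridI _ timesJ_subr.
Definition shiftJ (L : Type) (f : times GridJ -> L) : times GridI -> L :=
  f \o @time_map GridI GridJ _ timesI_subr.

End Times.

Definition causal (R : realType) (tau : {posnum R}) (K : grid) (L : zmodType)
    (F : (times tau K -> L) -> (times tau K -> L)) : Prop :=
  forall (f : times tau K -> L) (t : times tau K),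
    F f t = F (fun s => if val s <= val t then f s else 0) t.

(* The integrals run over the whole past, hence take values in [0, +oo].  If
   [0 < alpha 0], the right-hand one is +oo for every [f] vanishing before some
   time, and the inequality then says nothing about processes started at time
   0; the main statement therefore assumes [alpha 0 = 0]. *)
Definition passive (R : realType) (tau : {posnum R}) (K : grid)
    (L : zmodType) (alpha : L -> R)
    (F : (times tau K -> L) -> (times tau K -> L)) : Prop :=
  causal F /\
  forall (f : times tau K -> L) (t : times tau K),
    (\int[mu tau K]_(s in [set s | (val s < val t)%R]) (alpha (F f s))%:E
     <= \int[mu tau K]_(s in [set s | (val s < val t)%R]) (alpha (f s))%:E)%E.

Definition back_in_time (R : realType) (tau : {posnum R}) (K : grid)
    (U V : Type)
    (C : times tau K -> (times tau K -> U) -> V) : Prop :=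
  forall (t : times tau K) (f g : times tau K -> U),
    (forall s, val s <= val t -> f s = g s) -> C t f = C t g.

(* Isomorphisms of normed spaces are the linear homeomorphisms, as norms are
   considered up to equivalence; isometries are a special case. *)
Record normed_iso (K : numFieldType) (U V : normedModType K) := NormedIso {
  iso_fun :> {linear U -> V};
  iso_inv : V -> U;
  iso_funK : cancel iso_fun iso_inv;
  iso_invK : cancel iso_inv iso_fun;
  iso_fun_continuous : continuous iso_fun;
  iso_inv_continuous : continuous iso_inv }.

Section Propagating.
Variables (K : numFieldType) (L Pin Pout : normedModType K).
Variables (iin : normed_iso Pin L) (iout : normed_iso Pout L).

(* The swap of the two components, which live in distinct copies [Pin] and
   [Pout] of [L]. *)
Definition nb (z : Pin * Pout) : Pin * Pout :=
  (iso_inv iin (iout z.2), iso_inv iout (iin z.1)).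

Lemma nbK : involutive nb.
Proof. by case=> x y; rewrite /nb /= !iso_invK !iso_funK. Qed.

Definition connection_op (T : Type) (C : T -> (T -> Pout) -> Pin)
    (f : T -> L) (t : T) : L :=
  iout (nb (C t (iso_inv iout \o f), 0)).2.

Definition reflection_op (T : Type) (C : T -> (T -> Pin) -> Pout)
    (g : T -> L) (t : T) : L :=
  iin (nb (0, C t (iso_inv iin \o g))).1.

End Propagating.

Definition time_limited (R : realType) (tau : {posnum R}) (L : zmodType)
    (e : times tau GridI -> L) : Prop :=
  exists2 N : nat, (1 <= N)%N &
    forall t, e t <> 0 -> 0 <= val t < N%:R * tau%:num.

(* That [h] is the process; see [dsc_process_exists] and [dsc_process_unique]
   for the validity of the recursion. *)
Definition dsc_process (R : realType) (tau : {posnum R}) (L : zmodType)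
    (e : times tau GridI -> L)
    (FC : (times tau GridI -> L) -> (times tau GridI -> L))
    (FR : (times tau GridJ -> L) -> (times tau GridJ -> L))
    (h : times tau GridH -> L * L) : Prop :=
  let h1 (t : times tau GridI) := (h (inclI t)).1 in
  let h2 (t : times tau GridJ) := (h (inclJ t)).2 in
  [/\ forall t, val t <= 0 -> h t = (0, 0),
      forall t : times tau GridI, 0 <= val t ->
        h (nextI t) = (h1 t, shiftJ (FR (shiftI (e \+ h1))) t)
    & forall t : times tau GridJ, 0 <= val t ->
        h (nextJ t) = (shiftI (FC (shiftJ h2)) t, h2 t)].

Definition pair_norm (R : realType) (k : scalars)
    (L : normedModType (scalar_field R k)) (z : L * L) : R :=
  Num.sqrt (rnorm z.1 ^+ 2 + rnorm z.2 ^+ 2).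

Definition stable (R : realType) (T V : Type) (nrm : V -> R)
    (f : T -> V) : Prop :=
  exists M : R, forall t, nrm (f t) <= M.

Section DscProcessExistence.
Variables (R : realType) (tau : {posnum R}) (L : zmodType).
Variable e : times tau GridI -> L.
Variables (FC : (times tau GridI -> L) -> (times tau GridI -> L))
          (FR : (times tau GridJ -> L) -> (times tau GridJ -> L)).
Hypotheses (causalC : causal FC) (causalR : causal FR).

Local Notation seqH := (times tau GridH -> L * L).
Local Notation d := (tau%:num / 2).

Let d_gt0 : 0 < d. Proof. by []. Qed.

Let stepI (h : seqH) (t : times tau GridI) : L * L :=
  ((h (inclI t)).1, shiftJ (FR (shiftI (e \+ fun t => (h (inclI t)).1))) t).

Let stepJ (h : seqH) (t : times tau GridJ) : L * L :=
  (shiftI (FC (shiftJ (fun t => (h (inclJ t)).2))) t, (h (inclJ t)).2).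

Let step (h : seqH) (t : times tau GridH) : L * L :=
  if val t <= 0 then (0, 0) else
  match pselect (timesI tau (val t - d)), pselect (timesJ tau (val t - d)) with
  | left p, _ => stepI h (exist _ (val t - d) (mem_set p))
  | right _, left p => stepJ h (exist _ (val t - d) (mem_set p))
  | right _, right _ => (0, 0)
  end.

Let causal_eq (K : grid) (F : (times tau K -> L) -> (times tau K -> L)) f g t :
  causal F -> (forall s, val s <= val t -> f s = g s) -> F f t = F g t.
Proof.
move=> cF fg; rewrite cF [RHS]cF; congr (F _ t).
by apply/funext => s; case: ifPn => // /fg.
Qed.

Let step_local (h h' : seqH) t :
  (forall s, val s <= val t - d -> h s = h' s) -> step h t = step h' t.
Proof.
move=> hh'; rewrite /step; case: ifP => // _.
case: pselect => [p|_]; last case: pselect => [p|//].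
- rewrite /stepI hh' //; congr (_, _); rewrite /shiftJ /=.
  apply: causal_eq => // s /= st; rewrite /shiftI /= hh' //=.
  by have := d_gt0; lra.
- rewrite /stepJ hh' //; congr (_, _); rewrite /shiftI /=.
  apply: causal_eq => // s /= st; rewrite /shiftJ /= hh' //=.
  by have := d_gt0; lra.
Qed.

Let disjointIJ t : timesI tau t -> timesJ tau t -> False.
Proof.
case=> k _ <- [l _] /eqP; rewrite -subr_eq0.
have -> : (2 * l + 1)%:~R * tau%:num / 2 - k%:~R * tau%:num =
          (2 * l + 1 - 2 * k)%:~R * (tau%:num / 2) :> R.
  by rewrite !rmorphB /= !rmorphD !rmorphM /=; field.
rewrite mulf_eq0 (gt_eqF d_gt0) orbF intr_eq0; lia.
Qed.

Let step_nextI h (t : times tau GridI) :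
  0 <= val t -> step h (nextI t) = stepI h t.
Proof.
move=> t0; rewrite /step /= leNgt ltr_wpDl //=.
have ttd : val t + d - d = val t by rewrite addrK.
case: pselect => [p|[]]; last by rewrite ttd; exact: set_mem (valP t).
by congr stepI; apply: val_inj.
Qed.

Let step_nextJ h (t : times tau GridJ) :
  0 <= val t -> step h (nextJ t) = stepJ h t.
Proof.
move=> t0; rewrite /step /= leNgt ltr_wpDl //=.
have ttd : val t + d - d = val t by rewrite addrK.
have tJ : timesJ tau (val t) by exact: set_mem (valP t).
case: pselect => [p|_]; first by case: (@disjointIJ (val t)); rewrite // -ttd.
case: pselect => [p|[]]; last by rewrite ttd.
by congr stepJ; apply: val_inj.
Qed.

Let timesH_ge t : 0 < t -> grid_set tau GridH t -> d <= t.
Proof.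
move=> t0 tH; have [k tE] : exists k : int, t = k%:~R * d.
  case: tH => [] [k _ <-]; first by exists (2 * k); rewrite rmorphM /=; field.
  by exists (2 * k + 1); rewrite mulrA.
move: t0; rewrite tE pmulr_lgt0 // ltr0z => k0.
by apply: (ler_peMl (ltW d_gt0)); rewrite ler1z; lia.
Qed.

Let dsc_fixpoint h : dsc_process e FC FR h <-> forall t, h t = step h t.
Proof.
split=> [[h0 hI hJ] t|hE].
  have [t0|t0] := leP (val t) 0; first by rewrite h0 // /step t0.
  have td : 0 <= val t - d.
    by rewrite subr_ge0; exact: timesH_ge (set_mem (valP t)).
  have [p|p] := set_mem (valP t).
  - pose s : times tau GridJ := exist _ (val t - d) (mem_set (timesI_subr p)).
    have -> : t = nextJ s by apply: val_inj; rewrite /= subrK.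
    by rewrite hJ // step_nextJ.
  - pose s : times tau GridI := exist _ (val t - d) (mem_set (timesJ_subr p)).
    have -> : t = nextI s by apply: val_inj; rewrite /= subrK.
    by rewrite hI // step_nextI.
split=> [t t0|t t0|t t0]; first by rewrite hE /step t0.
- by rewrite hE step_nextI.
- by rewrite hE step_nextJ.
Qed.

Let rank (t : times tau GridH) : nat := (Num.bound `|val t / d|).+1.

Let agree_rank (h h' : nat -> seqH) :
  (forall n, h n.+1 = step (h n)) -> (forall n, h' n.+1 = step (h' n)) ->
  forall n t, val t <= n%:R * d -> h n.+1 t = h' n.+1 t.
Proof.
move=> hS h'S; elim=> [|n IHn] t tn.
  by rewrite hS h'S /step; move: tn; rewrite mul0r => ->.
rewrite hS h'S; apply: step_local => s st; apply: IHn.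
by move: tn; rewrite -natr1 mulrDl mul1r; lra.
Qed.

Let rank_le t : val t <= (rank t).-1%:R * d.
Proof.
rewrite -ler_pdivrMr // /rank.
by apply: le_trans (ler_norm _) (ltW (archi_boundP (normr_ge0 _))).
Qed.

Lemma dsc_process_unique h h' :
  dsc_process e FC FR h -> dsc_process e FC FR h' -> h = h'.
Proof.
move=> /dsc_fixpoint /funext hE /dsc_fixpoint /funext h'E; apply/funext => t.
by apply: (@agree_rank (fun=> h) (fun=> h') _ _ (rank t).-1 t).
Qed.

Lemma dsc_process_exists : exists h, dsc_process e FC FR h.
Proof.
pose g n : seqH := iter n step (fun=> (0, 0)).
have gm m t n : val t <= n%:R * d -> g (n + m).+1 t = g n.+1 t.
  by apply: (@agree_rank (fun n => g (n + m)%N) g).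
exists (fun t => g (rank t) t); apply/dsc_fixpoint => t.
have -> : g (rank t) t = g (rank t).+1 t.
  by rewrite -(@gm 1 t (rank t).-1) ?rank_le // addn1.
apply: (@step_local (g (rank t))) => s st.
have sn : val s <= (rank t).-1%:R * d.
  by apply: le_trans st _; rewrite lerBlDr (le_trans (rank_le t)) // lerDl ltW.
have sm := rank_le s; rewrite -[rank t]prednK // -[rank s]prednK //.
have [le|/ltnW le] := leqP (rank t).-1 (rank s).-1.
  by rewrite -(subnKC le) gm.
by rewrite -(subnKC le) gm.
Qed.

End DscProcessExistence.

(* Main.v *)
Require Import Defs.
From mathcomp Require Import all_boot all_order all_algebra.
From mathcomp Require Import all_classical all_reals all_analysis.
From mathcomp Require Import complex ring lra zify.
Set Implicit Arguments.
Unset Strict Implicit.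
Unset Printing Implicit Defensive.
Import Order.TTheory GRing.Theory Num.Theory.
Import numFieldNormedType.Exports.
Local Open Scope classical_set_scope.
Local Open Scope ring_scope.

(** Let [p n] be the value of [alpha] on the connection field [h1] at time
    n tau, [q n] its value on the reflection field [h2] at time
    n tau + tau / 2, and [r n] its value on the input [e + h1] at time n tau.
    Passivity of the reflection map says that the accumulated [q] is dominated
    by the accumulated [r], passivity of the connection map that the
    accumulated [p] is dominated by the accumulated [q], the output lagging
    behind the input in both cases ([passive_partial_sums]).  Once the
    excitation is over, [r] and [p] coincide, so the total [r] exceeds the
    total [p] by at most M, the sum of [r] over the first N periods.

    Going once around the loop therefore compares a total with the earlier
    total of the same sequence, plus M.  This does not bound the totals, but
    their difference contains the most recent term: every single [p n] and
    [q n] is at most M ([energy_exchange_bounded]).  Hence [alpha] is bounded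
    by M along the whole process ([dsc_energy_bounded]), and the growth
    condition in [delimiting] turns this into a bound of the norm.

    The integrals defining passivity run over an infinite past.  The signals
    concerned vanish before time 0, where [alpha] is zero, so the integral of
    the input is a finite sum; for the output it is enough to drop the
    possibly nonzero contribution of the negative times. *)

(** * Balance of accumulated energies *)

(** Chaining the two balances gives, with M the sum of [r] up to N,
    p 1 + ... + p n.+1 <= M + p 1 + ... + p n: the totals cancel
    except for the newest term.  The same holds for [q]. *)
Lemma energy_exchange_bounded (R : realDomainType) (p q r : nat -> R) (N : nat) :
  (forall n, 0 <= p n) -> (forall n, 0 <= q n) -> (forall n, 0 <= r n) ->
  p 0%N = 0 ->
  (forall n, (N <= n)%N -> r n = p n) ->
  (forall n, \sum_(i < n.+1) q i <= \sum_(i < n) r i) ->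
  (forall n, \sum_(i < n.+1) p i.+1 <= \sum_(i < n) q i) ->
  exists2 M, 0 <= M & forall n, p n <= M /\ q n <= M.
Proof.
move=> p0 q0 r0 pz rp qr pq.
pose M := \sum_(i < N) r i.
have M0 : 0 <= M by exact: sumr_ge0.
(* Up to N the left side is a partial sum of M; beyond N both sides grow by
   the same terms. *)
have rM n : \sum_(i < n) r i <= M + \sum_(i < n) p i.
  elim: n => [|n IHn]; first by rewrite !big_ord0 addr0.
  have [nN|Nn] := ltnP n N.
    have -> : M = \sum_(i < n.+1) r i + \sum_(n.+1 <= i < N) r i.
      by rewrite /M -!(big_mkord xpredT) -big_cat_nat.
    by rewrite -addrA lerDl addr_ge0 // sumr_ge0.
  by rewrite !big_ord_recr /= rp // addrA lerD2r.
have shift_p n : \sum_(i < n) p i <= \sum_(i < n) p i.+1.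
  case: n => [|n]; first by rewrite !big_ord0.
  by rewrite big_ord_recl big_ord_recr /= pz add0r lerDl.
exists M => // n; split.
  case: n => [|n]; first by rewrite pz.
  have := pq n; have := qr n; have := rM n; have := shift_p n.
  by rewrite !big_ord_recr /=; have := q0 n; lra.
have := pq n; have := qr n; have := rM n; have := shift_p n.
by rewrite !big_ord_recr /=; have := p0 n.+1; lra.
Qed.

(** * Passivity in terms of finite sums *)

Lemma integral_grid_image (R : realType) (tau : {posnum R}) (K : grid)
    (s : nat -> times tau K) (f : times tau K -> R) (n : nat) :
  injective s -> (forall x, 0 <= f x) ->
  (\int[mu tau K]_(x in s @` `I_n) (f x)%:E =
   (tau%:num * \sum_(i < n) f (s i))%:E)%E.
Proof.
move=> s_inj f0.
elim: n => [|n IHn].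
  by rewrite II0 image_set0 integral_set0 big_ord0 mulr0.
rewrite IIS image_setU image_set1 ge0_integral_setU //=; last 2 first.
- by move=> x _; rewrite lee_fin.
- apply/disj_setPS => _ [[i /= ni <-]] /s_inj ein.
  by rewrite ein ltnn in ni.
rewrite IHn (eq_integral (fun=> (f (s n))%:E)); last first.
  by move=> x /set_mem ->.
rewrite integral_cst //.
transitivity ((tau%:num * \sum_(i < n) f (s i))%:E
  + (f (s n))%:E * (tau%:num%:E * @counting _ R [set s n]))%E => //.
rewrite /counting/= asboolT; last exact: finite_set1.
rewrite fset_set1 finmap.cardfs1 big_ord_recr /= mule1 -EFinM -EFinD.
by rewrite mulrDr [f _ * _]mulrC.
Qed.

(** When [f] is supported on an increasing sequence of times [s], the
    integral of [alpha \o f] over the past of [s n] only sees s 0, ..., s n.-1,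
    because [alpha] vanishes at 0.  The integral of [alpha \o F f] over the
    same past may see more times, which can only increase it. *)
Lemma passive_partial_sums (R : realType) (tau : {posnum R}) (K : grid)
    (L : zmodType) (alpha : L -> R)
    (F : (times tau K -> L) -> (times tau K -> L))
    (s : nat -> times tau K) (f : times tau K -> L) (n : nat) :
  (forall z, 0 <= alpha z) -> alpha 0 = 0 -> passive alpha F ->
  {mono s : i j / (i < j)%N >-> val i < val j} ->
  (forall x, f x <> 0 -> exists i, x = s i) ->
  \sum_(i < n) alpha (F f (s i)) <= \sum_(i < n) alpha (f (s i)).
Proof.
move=> alpha0 alphaz [_ /(_ f (s n)) passF] s_mono f_supp.
have s_inj : injective s.
  move=> i j sij; apply/eqP; rewrite eqn_leq leqNgt [(j <= i)%N]leqNgt.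
  by rewrite -!s_mono sij ltxx.
have past : s @` `I_n `<=` [set x | val x < val (s n)].
  by move=> _ [i /= ni <-]; rewrite s_mono.
rewrite -(ler_pM2l (_ : 0 < tau%:num)) // -lee_fin.
rewrite -(integral_grid_image (f := alpha \o F f)) //; last by move=> x /=.
rewrite -(integral_grid_image (f := alpha \o f)) //; last by move=> x /=.
have lower : (\int[mu tau K]_(x in s @` `I_n) (alpha (F f x))%:E <=
    \int[mu tau K]_(x in [set x | (val x < val (s n))%R]) (alpha (F f x))%:E)%E.
  by apply: ge0_subset_integral => // x _; rewrite lee_fin.
apply: le_trans lower (le_trans passF _).
rewrite -[X in (_ <= \int[_]_(x in X) _)%E](setIidr past) integral_mkcondr.
rewrite le_eqVlt; apply/orP; left; apply/eqP.
apply: eq_integral => x /set_mem /= xs; rewrite patchE.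
case: ifPn => // /negP xS; congr EFin.
have [-> //|/eqP /f_supp [i xi]] := eqVneq (f x) 0.
by case: xS; apply/mem_set; exists i => //=; rewrite -s_mono -xi.
Qed.

(** * The two time grids indexed by integers *)

Section GridPoints.
Variables (R : realType) (tau : {posnum R}).

Definition atI (z : int) : times tau GridI :=
  exist _ (z%:~R * tau%:num) (mem_set (ex_intro2 _ _ z I erefl)).

Definition atJ (z : int) : times tau GridJ :=
  exist _ ((2 * z + 1)%:~R * tau%:num / 2) (mem_set (ex_intro2 _ _ z I erefl)).

Lemma atIP (t : times tau GridI) : exists z, t = atI z.
Proof. by have [z _ zt] := set_mem (valP t); exists z; apply: val_inj. Qed.

Lemma atJP (t : times tau GridJ) : exists z, t = atJ z.
Proof. by have [z _ zt] := set_mem (valP t); exists z; apply: val_inj. Qed.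

Lemma ltr_atI y z : (val (atI y) < val (atI z)) = (y < z).
Proof. by rewrite /= ltr_pM2r // ltr_int. Qed.

Lemma ltr_atJ y z : (val (atJ y) < val (atJ z)) = (y < z).
Proof. by rewrite /= !ltr_pM2r // ltr_int ltrD2r ltr_pM2l. Qed.

Lemma atI_ge0 z : (0 <= val (atI z)) = (0 <= z).
Proof. by rewrite /= pmulr_lge0 // ler0z. Qed.

Lemma atJ_ge0 z : (0 <= val (atJ z)) = (0 <= z).
Proof. by rewrite /= !pmulr_lge0 // ler0z; lia. Qed.

Lemma atJ_le0 z : (val (atJ z) <= 0) = (z < 0).
Proof. by rewrite /= !pmulr_lle0 // lerz0; lia. Qed.

Lemma nextI_atI z : nextI (atI z) = inclJ (atJ z).
Proof. by apply: val_inj; rewrite /= rmorphD rmorphM /=; field. Qed.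

Lemma nextJ_atJ z : nextJ (atJ z) = inclI (atI (z + 1)).
Proof. by apply: val_inj; rewrite /= !rmorphD rmorphM /=; field. Qed.

Lemma shiftI_atJ (T : Type) (f : times tau GridI -> T) z :
  shiftI f (atJ z) = f (atI z).
Proof.
by congr f; apply: val_inj; rewrite /= rmorphD rmorphM /=; field.
Qed.

Lemma shiftJ_atI (T : Type) (f : times tau GridJ -> T) z :
  shiftJ f (atI z) = f (atJ (z - 1)).
Proof.
congr f; apply: val_inj => /=.
by rewrite rmorphD rmorphM rmorphB /=; field.
Qed.

End GridPoints.

(** * The process and its bound *)

(** The balances of [energy_exchange_bounded] come from passivity along the
    times n tau - tau / 2 for the reflection map and n tau for the connection
    map.  In both cases the input at the first of these times is still zero,
    which is what produces the delay between the two sides. *)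
Lemma dsc_energy_bounded (R : realType) (tau : {posnum R}) (L : zmodType)
    (alpha : L -> R) (e : times tau GridI -> L)
    (FC : (times tau GridI -> L) -> (times tau GridI -> L))
    (FR : (times tau GridJ -> L) -> (times tau GridJ -> L))
    (h : times tau GridH -> L * L) :
  (forall z, 0 <= alpha z) -> alpha 0 = 0 ->
  passive alpha FC -> passive alpha FR -> time_limited e ->
  dsc_process e FC FR h ->
  exists M, forall t, alpha (h t).1 <= M /\ alpha (h t).2 <= M.
Proof.
move=> alpha0 alphaz passC passR [N _ e_supp] [h0 hI hJ].
pose h1 (t : times tau GridI) := (h (inclI t)).1.
pose h2 (t : times tau GridJ) := (h (inclJ t)).2.
have e_atI z : ~~ (0 <= z < N%:Z) -> e (atI tau z) = 0.
  move=> zN; apply: contrapT => /e_supp; rewrite atI_ge0.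
  by rewrite /= ltr_pM2r // -[N%:R]/(N%:Z%:~R) ltr_int; exact/negP.
have h1_atI z : z <= 0 -> h1 (atI tau z) = 0.
  by move=> z0; rewrite /h1 h0 // /= pmulr_lle0 // lerz0.
have h2_atJ z : z < 0 -> h2 (atJ tau z) = 0.
  by move=> z0; rewrite /h2 h0 // atJ_le0.
have h_atJ (n : nat) : h (inclJ (atJ tau n)) =
    (h1 (atI tau n), FR (shiftI (e \+ h1)) (atJ tau (n%:Z - 1))).
  by rewrite -nextI_atI hI ?atI_ge0 // shiftJ_atI.
have h_atI (n : nat) : h (inclI (atI tau n.+1)) =
    (FC (shiftJ h2) (atI tau n), h2 (atJ tau n)).
  by rewrite -addn1 PoszD -nextJ_atJ hJ ?atJ_ge0 // shiftI_atJ.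
have [|||||||M M0 hM] := @energy_exchange_bounded R
  (fun n => alpha (h1 (atI tau n))) (fun n => alpha (h2 (atJ tau n)))
  (fun n => alpha ((e \+ h1) (atI tau n))) N => //.
- by rewrite h1_atI.
- by move=> n Nn /=; rewrite e_atI ?add0r //; lia.
- move=> n.
  have := @passive_partial_sums R tau GridJ L alpha FR
    (fun i => atJ tau (i%:Z - 1)) (shiftI (e \+ h1)) n.+1 alpha0 alphaz passR.
  (* The times are atJ (i - 1), as h2 at atJ i is the output of FR there. *)
  rewrite [X in _ -> _ -> _ <= X]big_ord_recl shiftI_atJ /= e_atI //.
  rewrite h1_atI // addr0 alphaz add0r => P.
  under eq_bigr do rewrite /h2 h_atJ.
  apply: le_trans (P _ _) _.
  + by move=> i j; rewrite ltr_atJ; lia.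
  + move=> x; have [z ->] := atJP x; rewrite shiftI_atJ => fz.
    exists (absz (z + 1)); congr atJ.
    have [z0|z0] := leP 0 z; first by lia.
    by case: fz; rewrite /= e_atI ?h1_atI ?addr0 //; lia.
  + apply: ler_sum => i _; rewrite shiftI_atJ /bump /=.
    by rewrite (_ : (1 + i)%:Z - 1 = i) //; lia.
- move=> n.
  have := @passive_partial_sums R tau GridI L alpha FC
    (fun i => atI tau i) (shiftJ h2) n.+1 alpha0 alphaz passC.
  rewrite [X in _ -> _ -> _ <= X]big_ord_recl shiftJ_atI h2_atJ //.
  rewrite alphaz add0r => P.
  under eq_bigr do rewrite /h1 h_atI.
  apply: le_trans (P _ _) _.
  + by move=> i j; rewrite ltr_atI; lia.
  + move=> x; have [z ->] := atIP x; rewrite shiftJ_atI => fz.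
    exists (absz z); congr atI.
    have [z0|z0] := leP 0 z; first by lia.
    by case: fz; rewrite h2_atJ //; lia.
  + apply: ler_sum => i _; rewrite shiftJ_atI /bump /=.
    by rewrite (_ : (1 + i)%:Z - 1 = i) //; lia.
have zM : alpha 0 <= M by rewrite alphaz.
exists M => t.
have [t0|t0] := leP (val t) 0; first by rewrite h0.
have [p|p] := set_mem (valP t).
(* At a time of I the second component is the value of h2 half a period
   earlier. *)
- have [z tz] := atIP (exist _ (val t) (mem_set p)).
  have tE : t = inclI (atI tau z) by apply: val_inj; rewrite -tz.
  have z0 : 0 < z.
    by move: t0; rewrite tE /= pmulr_lgt0 // ltr0z.
  rewrite tE; case: z z0 {tz tE} => // -[//|n] _.
  split; first by case: (hM n.+1).
  by rewrite h_atI; case: (hM n).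
(* At a time of J the first component is the value of h1 half a period
   earlier. *)
- have [z tz] := atJP (exist _ (val t) (mem_set p)).
  have tE : t = inclJ (atJ tau z) by apply: val_inj; rewrite -tz.
  have z0 : 0 <= z.
    by move: (ltW t0); rewrite tE [val _]/(val (atJ tau z)) atJ_ge0.
  rewrite tE; case: z z0 {tz tE} => // n _.
  by split; [rewrite h_atJ; case: (hM n)|case: (hM n)].
Qed.

Lemma rnorm_ge0 (R : realType) (k : scalars)
    (L : normedModType (scalar_field R k)) (z : L) : 0 <= rnorm z.
Proof.
rewrite /rnorm; case: k L z => L z /=; first exact: normr_ge0.
by have := normr_ge0 z; rewrite lecE => /andP[].
Qed.

Theorem theorem3p1 (R : realType) (k : scalars)
  (L Pin Pout : normedModType (scalar_field R k))
  (iin : normed_iso Pin L) (iout : normed_iso Pout L)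
  (tau : {posnum R}) (alpha : L -> R)
  (Cm : times tau GridI -> (times tau GridI -> Pout) -> Pin)
  (Rm : times tau GridJ -> (times tau GridJ -> Pin) -> Pout) :
  delimiting alpha ->
  alpha 0 = 0 ->
  back_in_time Cm ->
  back_in_time Rm ->
  passive alpha (connection_op iin iout Cm) ->
  passive alpha (reflection_op iin iout Rm) ->
  forall e : times tau GridI -> L, time_limited e ->
  forall h : times tau GridH -> L * L,
    dsc_process e (connection_op iin iout Cm) (reflection_op iin iout Rm) h ->
    stable (@pair_norm R k L) h.
Proof.
move=> [_ alpha0 [a [b [c [a0 b0 c0 norm_le]]]]] alphaz _ _ passC passR e e_lim
  h hE.
have [M hM] := dsc_energy_bounded alpha0 alphaz passC passR e_lim hE.
pose B := a + b * M `^ c.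
have norm_leB z : alpha z <= M -> rnorm z <= B.
  move=> zM; apply: le_trans (norm_le z) _.
  rewrite lerD2l ler_wpM2l // ge0_ler_powR // nnegrE //.
  exact: le_trans (alpha0 z) zM.
exists (Num.sqrt (B ^+ 2 + B ^+ 2)) => t; have [h1M h2M] := hM t.
by rewrite ler_wsqrtr // lerD // lerXn2r ?nnegrE ?rnorm_ge0 ?norm_leB //;
  apply: le_trans (rnorm_ge0 _) (norm_leB _ _); eassumption.
Qed.
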